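(* Assume $\underline{\gamma} < 0 < \overline{\gamma}$ and $\underline{\beta} < 0 < \overline{\beta}$. Then $\operatorname{conv}(T) = R^1$.
   Context: Let $\underline{\gamma}, \overline{\gamma}, \underline{\beta}, \overline{\beta}$ be real parameters; $\operatorname{conv}$ denotes the convex hull. The set $T \subseteq \mathbb{R}^5$ consists of all $(x,u,y,z,t)$ satisfying $$u = x t,\quad y + u \le 0,\quad z + x \le 1,\quad y \le \overline{\beta} z,\quad y \ge \underline{\beta} z,\quad z \ge 0,\quad x \in [0,1],\quad t \in [\underline{\gamma}, \overline{\gamma}].$$ The set $R^0 \subseteq \mathbb{R}^5$ consists of all $(x,u,y,z,t)$ satisfying $$y + u \le 0,\quad z + x \le 1,\quad y \le \overline{\beta} z,\quad y \ge \underline{\beta} z,$$ $$u - \underline{\gamma} x \ge 0,\quad \overline{\gamma} x - u \ge 0,\quad u - \underline{\gamma} x \le t - \underline{\gamma},\quad \overline{\gamma} x - u \le \overline{\gamma} - t.$$ The set $R^1$ consists of all $(x,u,y,z,t) \in R^0$ satisfying both $$(u - \underline{\beta} x)(u - \underline{\gamma} x) \leq - \underline{\beta}\, x (t - \underline{\gamma})$$ and, in case $y > 0$ (no condition is imposed when $y \le 0$), $$(\overline{\gamma} - \underline{\gamma})y + \overline{\beta}(\overline{\gamma} x - u) + \frac{\underline{\gamma}\, y(u - \underline{\gamma} x)}{y + u - \underline{\gamma} x} \leq \overline{\beta} ( \overline{\gamma} - t ).$$ *)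

(* Defs.v *)
From HB Require Import structures.
From mathcomp Require Import all_boot all_order all_algebra.
From mathcomp Require Import classical_sets reals convex.

Set Implicit Arguments.
Unset Strict Implicit.
Unset Printing Implicit Defensive.

Import Order.TTheory GRing.Theory Num.Theory.

Local Open Scope classical_set_scope.
Local Open Scope ring_scope.

Definition convex_hull (R : realType) (E : lmodType R) (A : set E) : set E :=
  smallest (@convex_set R E) A.

(* The coordinates (x, u, y, z, t) of a vector of R^5; the column indices are
   the numerals 0, ..., 4 of the ring structure on 'I_5. *)
Definition cx (R : realType) (v : 'rV[R]_5) : R := v 0 0.
Definition cu (R : realType) (v : 'rV[R]_5) : R := v 0 1.
Definition cy (R : realType) (v : 'rV[R]_5) : R := v 0 2.
Definition cz (R : realType) (v : 'rV[R]_5) : R := v 0 3.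
Definition ct (R : realType) (v : 'rV[R]_5) : R := v 0 4.

(* In the sets below, gl and gu stand for the lower and upper bounds gamma,
   and bl and bu for the lower and upper bounds beta. *)

Definition T_set (R : realType) (gl gu bl bu : R) : set 'rV[R]_5 :=
  [set v | let x := cx v in let u := cu v in let y := cy v in
           let z := cz v in let t := ct v in
    [/\ u = x * t, y + u <= 0 & z + x <= 1] /\
    [/\ y <= bu * z, y >= bl * z & z >= 0] /\
    (0 <= x <= 1 /\ gl <= t <= gu)].

Definition R0_set (R : realType) (gl gu bl bu : R) : set 'rV[R]_5 :=
  [set v | let x := cx v in let u := cu v in let y := cy v in
           let z := cz v in let t := ct v in
    [/\ y + u <= 0, z + x <= 1, y <= bu * z & y >= bl * z] /\
    [/\ u - gl * x >= 0, gu * x - u >= 0,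
        u - gl * x <= t - gl & gu * x - u <= gu - t]].

(* On R0_set, 0 < y makes the denominator y + u - gl * x positive. *)
Definition R1_set (R : realType) (gl gu bl bu : R) : set 'rV[R]_5 :=
  [set v | let x := cx v in let u := cu v in let y := cy v in
           let t := ct v in
    [/\ R0_set gl gu bl bu v,
        (u - bl * x) * (u - gl * x) <= - bl * x * (t - gl) &
        0 < y ->
        (gu - gl) * y + bu * (gu * x - u)
          + (gl * y * (u - gl * x)) / (y + u - gl * x)
          <= bu * (gu - t)]].

(* Main.v *)
Require Import Defs.
From mathcomp Require Import all_boot all_order all_algebra.
From mathcomp Require Import interval_inference classical_sets reals convex.
From mathcomp Require Import ring lra.

(** Write gl, gu, bl, bu for the bounds, w = u - gl x and s = t - gl.

    R1 contains the hull because it is a convex set containing T. Its two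
    nonlinear inequalities are convex for a reason that linearizes them: the
    first one bounds w^2 / x, which is the maximum over th of
    2 th w - th^2 x, and the second one involves y w / (y + w), which is the
    minimum over th of th^2 y + (1 - th)^2 w and is multiplied by gl < 0. So R1
    is an intersection of half-spaces (lemma R1_tangents).

    For the converse, fix x, u, y, z. The inequalities of R1 that involve t
    confine it to an interval [a, b], whose ends depend on x, u, y, z, so
    it is enough to write the two end points as convex combinations of points
    of T. Each end is a value of t at which one inequality is tight, and the
    equality case of that inequality dictates the support of the combination:

    - t = gl + (u - gl x) for u <= 0, and t = gu + (u - gu x) for 0 <= u
      (mccormick_facet): (x, t) = (1, 0) and a point with t = gl, resp. t = gu;
    - t = gu + (u - gu x) for u <= 0 and y <= 0 (mccormick_facet_upper):
      (x, t) = (1, u / x) and (0, gu);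
    - tight first nonlinear inequality, for 0 < u (quadratic_facet): a point on
      the curve x t = - bl (1 - x), and (x, t) = (0, gl);
    - tight second nonlinear inequality, for 0 < y (harmonic_facet): a point on
      the curve x t = - bu (1 - x), and (x, t) = (1, gl), (0, gu).

    Combinations are handled through masses: a point of mass p is p times a
    point of the set, and masses and vectors add up. This avoids dividing by
    weights that may vanish. *)

Set Implicit Arguments.
Unset Strict Implicit.
Unset Printing Implicit Defensive.
Import Order.TTheory GRing.Theory Num.Theory.
Local Open Scope classical_set_scope.
Local Open Scope ring_scope.

(** * Convex combinations and masses *)

Section ConvexCones.
Context {R : realFieldType} {E : lmodType R}.
Implicit Types (A : set E) (p q : R) (v w : E).

(** A form of convexity with real weights instead of weights packed with the
    proof that they lie in [0, 1]. *)
Lemma convex_setP A : @convex_set R E A <->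
  forall p q v w, 0 <= p -> 0 <= q -> p + q = 1 ->
    A v -> A w -> A (p *: v + q *: w).
Proof.
split=> [cA p q v w p0 q0 pq Av Aw | cA v w l /set_mem Av /set_mem Aw].
  have p1 : p <= 1 by lra.
  have := cA v w (Itv01 p0 p1) (mem_set Av) (mem_set Aw).
  move/set_mem; rewrite /conv/= (_ : unstable.onem p = q) //.
  by rewrite /unstable.onem; lra.
apply/mem_set; rewrite /conv/=; apply: cA => //.
  by rewrite unstable.onem_ge0.
by rewrite /unstable.onem addrC subrK.
Qed.

(** The fibre at height p of the cone spanned by A x {1}. At p = 0 it is
    reduced to {0} rather than to the recession cone of A. *)
Definition hcone A p v := 0 <= p /\ exists2 w, A w & v = p *: w.

Lemma hcone1 A v : hcone A 1 v -> A v.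
Proof. by case=> _ [w Aw ->]; rewrite scale1r. Qed.

(** For p + q > 0 the base point of the sum is the average of the two base
    points with weights p / (p + q) and q / (p + q). *)
Lemma hconeD A p q v w : @convex_set R E A ->
  hcone A p v -> hcone A q w -> hcone A (p + q) (v + w).
Proof.
move=> /convex_setP cA [p0 [v' Av ->]] [q0 [w' Aw ->]].
split; first exact: addr_ge0.
have [pq0|pq0] := eqVneq (p + q) 0.
  have {pq0} [-> ->] : p = 0 /\ q = 0.
    by move/eqP: pq0; rewrite paddr_eq0 // => /andP[/eqP-> /eqP->].
  by exists v' => //; rewrite addr0 !scale0r addr0.
exists ((p / (p + q)) *: v' + (q / (p + q)) *: w').
  by apply: cA; rewrite ?divr_ge0 ?addr_ge0 // -mulrDl divff.
by rewrite scalerDr !scalerA ![(p + q) * _]mulrC !divfK.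
Qed.

End ConvexCones.

(** * Coordinates in R^5 *)

Section Coords.
Context {R : realType}.

Definition vec5 (x u y z t : R) : 'rV[R]_5 := \row_i [:: x; u; y; z; t]`_i.

Lemma vec5E (x u y z t : R) :
  ((cx (vec5 x u y z t) = x) * (cu (vec5 x u y z t) = u) *
  (cy (vec5 x u y z t) = y) * (cz (vec5 x u y z t) = z) *
  (ct (vec5 x u y z t) = t))%type.
Proof. by rewrite /cx /cu /cy /cz /ct !mxE. Qed.

Lemma vec5K (v : 'rV[R]_5) : vec5 (cx v) (cu v) (cy v) (cz v) (ct v) = v.
Proof.
apply/rowP => i; rewrite mxE /cx /cu /cy /cz /ct.
by case: i => [[|[|[|[|[|//]]]]] lti] /=; congr (v _ _); apply/val_inj.
Qed.

Lemma vec5D x1 u1 y1 z1 t1 x2 u2 y2 z2 t2 :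
  vec5 x1 u1 y1 z1 t1 + vec5 x2 u2 y2 z2 t2 =
  vec5 (x1 + x2) (u1 + u2) (y1 + y2) (z1 + z2) (t1 + t2).
Proof.
by apply/rowP; case=> [[|[|[|[|[|//]]]]] lti]; rewrite !mxE.
Qed.

Lemma vec5Z k x u y z t :
  k *: vec5 x u y z t = vec5 (k * x) (k * u) (k * y) (k * z) (k * t).
Proof.
by apply/rowP; case=> [[|[|[|[|[|//]]]]] lti]; rewrite !mxE.
Qed.

End Coords.

(** * Linearization of the two nonlinear inequalities *)

Section Tangents.
Context {R : realFieldType}.
Implicit Types x y w r g k th d : R.

(** Expand 0 <= (w - th x)^2 and divide by x; equality holds at th = w / x. The
    side condition at x = 0 is what makes both sides true there. *)
Lemma quad_over_lin_tangents x w r : 0 <= x -> (x = 0 -> w = 0 /\ 0 <= r) ->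
  w ^+ 2 <= x * r <-> forall th, 2 * th * w - th ^+ 2 * x <= r.
Proof.
rewrite le_eqVlt => /orP[/eqP x0 /(_ (esym x0))[-> r0] | x0 _].
  rewrite -x0; split=> [_ th|_]; last by rewrite expr0n/= mul0r.
  by rewrite !mulr0 subr0.
split=> [wxr th | tan].
  rewrite -(ler_pM2l x0); apply: le_trans wxr.
  have := sqr_ge0 (w - th * x); lra.
have := tan (w / x); rewrite -(ler_pM2l x0).
by rewrite (_ : x * (_ - _) = w ^+ 2) //; field; rewrite gt_eqF.
Qed.

(** For 0 < y, the difference (y + w) (th^2 y + (1 - th)^2 w) - y w is the
    square of th y - (1 - th) w, which vanishes at th = w / (y + w). For
    y <= 0, the left-hand sides of the linear inequalities are nonpositive: the
    coefficient of y is at least k + g > 0, that of w is at most 0. So they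
    match the absence of a condition. *)
Lemma harmonic_tangents g k y w d :
  g < 0 -> - g < k -> 0 <= w -> 0 <= d ->
  (0 < y -> k * y + g * y * w / (y + w) <= d) <->
  forall th, 0 <= th <= 1 ->
    k * y + g * (th ^+ 2 * y + (1 - th) ^+ 2 * w) <= d.
Proof.
move=> g0 kg w0 d0; split=> [h th /andP[th0 th1] | h y0].
  have [y0|y0] := ltP 0 y.
    apply: le_trans (h y0); rewrite lerD2l -!mulrA ler_nM2l //.
    have yw : 0 < y + w by lra.
    rewrite mulrA ler_pdivrMr //.
    have := sqr_ge0 (th * y - (1 - th) * w); lra.
  have t1 : th ^+ 2 <= 1 by rewrite expr_le1.
  have c1 : 0 <= (k + g * th ^+ 2) * - y.
    apply: mulr_ge0; last lra.
    have : 0 <= - g * (1 - th ^+ 2) by apply: mulr_ge0; lra.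
    lra.
  have c2 : 0 <= - g * ((1 - th) ^+ 2 * w).
    by apply: mulr_ge0; [lra | apply: mulr_ge0 => //; apply: sqr_ge0].
  lra.
have yw : 0 < y + w by lra.
have := h (w / (y + w)); rewrite (_ : 0 <= _ <= 1); last first.
  by rewrite divr_ge0 ?(ltW yw)//= ler_pdivrMr // mul1r; lra.
move=> /(_ isT); apply: le_trans; rewrite lerD2l le_eqVlt; apply/orP; left.
by apply/eqP; field; rewrite gt_eqF.
Qed.

End Tangents.

(** * Convexity of R1 and validity of its inequalities on T *)

Section Hull.
Context {R : realType} {gl gu bl bu : R}.
Notation T := (T_set gl gu bl bu).
Notation R1 := (R1_set gl gu bl bu).
Notation R0 := (R0_set gl gu bl bu).

(** With w = u - gl x and s = t - gl, the first nonlinear inequality is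
    w^2 <= x (- bl s - (gl - bl) w). *)
Lemma R1_tangents v : gl < 0 -> 0 < gu -> bl < 0 -> 0 < bu -> R1 v <->
  [/\ R0 v,
     forall th, 2 * th * (cu v - gl * cx v) - th ^+ 2 * cx v
                <= - bl * (ct v - gl) - (gl - bl) * (cu v - gl * cx v) &
     forall th, 0 <= th <= 1 ->
       (gu - gl) * cy v
       + gl * (th ^+ 2 * cy v + (1 - th) ^+ 2 * (cu v - gl * cx v))
       <= bu * (gu - ct v) - bu * (gu * cx v - cu v)].
Proof.
move=> hgl hgu hbl hbu; set w := cu v - gl * cx v.
have key : R0 v ->
    ((cu v - bl * cx v) * w <= - bl * cx v * (ct v - gl) <->
     forall th, 2 * th * w - th ^+ 2 * cx v
                <= - bl * (ct v - gl) - (gl - bl) * w) /\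
    ((0 < cy v ->
      (gu - gl) * cy v + bu * (gu * cx v - cu v)
          + (gl * cy v * w) / (cy v + cu v - gl * cx v)
          <= bu * (gu - ct v)) <->
     forall th, 0 <= th <= 1 ->
       (gu - gl) * cy v + gl * (th ^+ 2 * cy v + (1 - th) ^+ 2 * w)
       <= bu * (gu - ct v) - bu * (gu * cx v - cu v)).
  move=> [[_ _ _ _]]; rewrite -/w.
  have : cu v = w + gl * cx v by rewrite subrK.
  rewrite -[cy v + _ - _]addrA -/w.
  move: (cx v) (cu v) (cy v) (ct v) w => x u y t w -> [w0 gx0 ws gxs].
  have x0 : 0 <= x.
    have gul : 0 < gu - gl by lra.
    have : 0 <= (gu - gl) * x by lra.
    by rewrite pmulr_rge0.
  split.
    rewrite -quad_over_lin_tangents //; last first.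
      move=> xE; move: gx0 ws gxs; rewrite xE !mulr0 => gx0 ws gxs.
      have w00 : w = 0 by apply/eqP; rewrite eq_le w0 andbT; lra.
      have s0 : 0 <= t - gl by lra.
      by rewrite w00 mulr0 subr0; split=> //; apply: mulr_ge0 => //; lra.
    by split=> ?; lra.
  have d0 : 0 <= bu * (gu - t) - bu * (gu * x - (w + gl * x)).
    by rewrite -mulrBr; apply: mulr_ge0; lra.
  rewrite -harmonic_tangents //; last lra.
  by split=> h y0; have := h y0; lra.
split=> [[r0 h1 h2] | [r0 h1 h2]]; have [k1 k2] := key r0.
  by split=> //; [apply/k1 | apply/k2].
by split=> //; [apply/k1 | apply/k2].
Qed.

Lemma convex_R1 : gl < 0 -> 0 < gu -> bl < 0 -> 0 < bu ->
  @convex_set R _ R1.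
Proof.
move=> hgl hgu hbl hbu.
have tan v : R1 v <-> _ := R1_tangents v hgl hgu hbl hbu.
apply/convex_setP => p q v v' p0 q0 pq /tan[r h1 h2].
move=> /tan[r' h1' h2']; apply/tan.
have qE : q = 1 - p by lra.
have comb (a b a' b' : R) :
    a <= b -> a' <= b' -> p * a + q * a' <= p * b + q * b'.
  by move=> ab ab'; apply: lerD; apply: ler_wpM2l.
rewrite /R0_set /=.
have [-> -> -> -> ->] : [/\ cx (p *: v + q *: v') = p * cx v + q * cx v',
    cu (p *: v + q *: v') = p * cu v + q * cu v',
    cy (p *: v + q *: v') = p * cy v + q * cy v',
    cz (p *: v + q *: v') = p * cz v + q * cz v' &
    ct (p *: v + q *: v') = p * ct v + q * ct v'].
  by rewrite /cx /cu /cy /cz /ct !mxE.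
case: r => [[a1 a2 a3 a4] [a5 a6 a7 a8]].
case: r' => [[b1 b2 b3 b4] [b5 b6 b7 b8]].
split.
- by split; split; [have := comb _ _ _ _ a1 b1 | have := comb _ _ _ _ a2 b2
    | have := comb _ _ _ _ a3 b3 | have := comb _ _ _ _ a4 b4
    | have := comb _ _ _ _ a5 b5 | have := comb _ _ _ _ a6 b6
    | have := comb _ _ _ _ a7 b7 | have := comb _ _ _ _ a8 b8]; subst q; lra.
- by move=> th; have := comb _ _ _ _ (h1 th) (h1' th); subst q; lra.
- move=> th th01.
  by have := comb _ _ _ _ (h2 th th01) (h2' th th01); subst q; lra.
Qed.

Lemma T_sub_R1 : gl < 0 -> 0 < gu -> bl < 0 -> 0 < bu -> T `<=` R1.
Proof.
move=> hgl hgu hbl hbu v; rewrite /T_set /R1_set /R0_set /=.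
move: (cx v) (cu v) (cy v) (cz v) (ct v) => x u y z t.
move=> [[-> yu zx] [[ybu ybl z0] [/andP[x0 x1] /andP[glt tgu]]]].
have s0 : 0 <= t - gl by lra.
have s1 : 0 <= gu - t by lra.
have x1' : 0 <= 1 - x by lra.
have zx' : 0 <= 1 - x - z by lra.
have w0 : 0 <= x * (t - gl) by apply: mulr_ge0.
have w1 : 0 <= x * (gu - t) by apply: mulr_ge0.
have w2 : 0 <= (1 - x) * (t - gl) by apply: mulr_ge0.
have w3 : 0 <= (1 - x) * (gu - t) by apply: mulr_ge0.
have hbl' : 0 <= - bl by lra.
have bz : 0 <= - bl * (1 - x - z) by apply: mulr_ge0.
have Bz : 0 <= bu * (1 - x - z) by apply: mulr_ge0 => //; apply: ltW.
split; first by split; split; lra.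
  (* x t <= - y <= - bl z <= - bl (1 - x) *)
  have c0 : 0 <= - bl * (1 - x) - x * t by lra.
  have : 0 <= x * (t - gl) * (- bl * (1 - x) - x * t) by apply: mulr_ge0.
  lra.
move=> y0; have yw : 0 < y + x * t - gl * x by lra.
(* The denominator is at most - gl x, because y + x t <= 0. *)
have ratio :
    gl * y * (x * t - gl * x) / (y + x * t - gl * x) <= - y * (t - gl).
  rewrite ler_pdivrMr //.
  have : 0 <= y * (t - gl) * - (y + x * t).
    by apply: mulr_ge0; [apply: mulr_ge0 => //; apply: ltW | lra].
  lra.
have : 0 <= (bu * (1 - x) - y) * (gu - t) by apply: mulr_ge0 => //; lra.
lra.
Qed.

(** * Decomposition of the points of R1 *)

Section Decomposition.
Variable C : set 'rV[R]_5.
Hypotheses (cC : @convex_set R _ C) (TC : T `<=` C).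

Lemma hcone_vec5D (p x u y z t q x' u' y' z' t' : R) :
  hcone C p (vec5 x u y z t) -> hcone C q (vec5 x' u' y' z' t') ->
  hcone C (p + q) (vec5 (x + x') (u + u') (y + y') (z + z') (t + t')).
Proof. by rewrite -vec5D; apply: hconeD. Qed.

Lemma segment_t (x u y z t a b : R) :
  C (vec5 x u y z a) -> C (vec5 x u y z b) -> a <= t -> t <= b ->
  C (vec5 x u y z t).
Proof.
move=> Ca Cb at_ tb; have [ab|ab] := eqVneq a b.
  by rewrite (_ : t = a) //; apply/eqP; rewrite eq_le at_ ab tb.
have ba : 0 < b - a by rewrite subr_gt0 lt_neqAle ab (le_trans at_).
pose p := (b - t) / (b - a); pose q := (t - a) / (b - a).
have pq : p + q = 1 by rewrite /p /q; field; rewrite gt_eqF.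
have pqE c : p * c + q * c = c by rewrite -mulrDl pq mul1r.
have -> : vec5 x u y z t = p *: vec5 x u y z a + q *: vec5 x u y z b.
  rewrite !vec5Z vec5D !pqE; congr vec5.
  by rewrite /p /q; field; rewrite gt_eqF.
have /convex_setP := cC; apply=> //; rewrite divr_ge0 ?(ltW ba) //; lra.
Qed.

(** The constraints of T multiplied by p, for the vector p (x, u, y, z, t).
    The equation u = x t becomes u p = x t, which does not force u = 0 at p = 0;
    the other constraints do force x, y, z, t to vanish there. *)
Lemma hcone_mass (p x u y z t : R) : gl < 0 -> 0 < gu ->
  0 <= p -> u * p = x * t -> (p = 0 -> u = 0) ->
  y + u <= 0 -> z + x <= p -> bl * z <= y -> y <= bu * z -> 0 <= z ->
  0 <= x -> gl * p <= t -> t <= gu * p ->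
  hcone C p (vec5 x u y z t).
Proof.
move=> hgl hgu p0 uE u0 yu zx ybl ybu z0 x0 glt tgu; split=> //.
have [pE|pN] := eqVneq p 0.
  exists (vec5 0 0 0 0 0).
    apply: TC; rewrite /T_set /= !vec5E !mulr0 !addr0 !lexx ler01.
    repeat split=> //.
    by rewrite !ltW.
  have xE : x = 0 by lra.
  have zE : z = 0 by lra.
  have tE : t = 0 by move: glt tgu; rewrite pE; lra.
  have yE : y = 0 by move: ybl ybu; rewrite zE; lra.
  by rewrite vec5Z xE zE yE tE u0 // !mulr0.
have pp : 0 < p by rewrite lt_neqAle eq_sym pN.
exists (vec5 (x / p) (u / p) (y / p) (z / p) (t / p)); last first.
  by rewrite vec5Z; congr vec5; rewrite mulrC divfK.
have ip : 0 < p^-1 by rewrite invr_gt0.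
apply: TC; rewrite /T_set /= !vec5E; repeat split.
- by rewrite mulf_div -uE -mulf_div divff // mulr1.
- by rewrite -mulrDl pmulr_lle0.
- by rewrite -mulrDl ler_pdivrMr // mul1r.
- by rewrite mulrA ler_pM2r.
- by rewrite mulrA ler_pM2r.
- by rewrite divr_ge0.
- by rewrite divr_ge0 //= ler_pdivrMr // mul1r; lra.
- by rewrite ler_pdivlMr // glt ler_pdivrMr.
Qed.

(** With u = g a, the value of t is the one at which the mean of
    (1 - x) (t - g) vanishes; this is a tight McCormick inequality when g is gl
    or gu, and then every support point has x = 1 or t = g. Among the points
    with x = 1, the one with t = 0 leaves no slack in y + u <= 0 when
    y = z = 0, the only value of (y, z) that it allows, so that the other
    point, of mass 1 - p, carries all of u, y and z. *)
Lemma mccormick_facet (g a x y z : R) : gl < 0 -> 0 < gu ->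
  gl <= g -> g <= gu -> 0 <= a -> a <= x -> x <= 1 ->
  y + g * a <= 0 -> z + x <= 1 -> bl * z <= y -> y <= bu * z -> 0 <= z ->
  C (vec5 x (g * a) y z (g + (g * a - g * x))).
Proof.
move=> hgl hgu glg ggu a0 ax x1 yu zx ybl ybu z0.
(* The mass of (x, t) = (1, 0). *)
pose p := x - a.
have [p0 p1] : 0 <= p /\ 0 <= 1 - p by rewrite /p; split; lra.
apply: hcone1.
rewrite (_ : 1 = p + (1 - p)); last by rewrite addrC subrK.
have -> : vec5 x (g * a) y z (g + (g * a - g * x)) =
  vec5 (p + a) (0 + g * a) (0 + y) (0 + z) (0 + g * (1 - p)).
  by congr vec5; rewrite /p; ring.
apply: hcone_vec5D; apply: hcone_mass => //;
  rewrite ?mul0r ?mulr0 ?addr0 ?add0r //.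
- by apply: mulr_le0_ge0 => //; apply: ltW.
- by apply: mulr_ge0 => //; apply: ltW.
- by rewrite mulrA [g * a]mulrC.
- by move=> pE; rewrite (_ : a = 0) ?mulr0 //; rewrite /p in pE; lra.
- by rewrite /p; lra.
- exact: ler_wpM2r.
- exact: ler_wpM2r.
Qed.

(** Divided by x, the first nonlinear inequality bounds w^2 / x by a linear form
    in (w, s), with w = u - gl x and s = t - gl. Points of T with equality have
    t = gl, so that w = s = 0, or x t = - bl (1 - x). Equality in the
    subadditivity of w^2 / x makes w / x = t - gl common to all support points
    with x > 0, so these reduce to one point on the curve, with t = u / x,
    and the only other support point is (0, gl). The point on the curve allows
    only (y, z) = (bl (1 - x), 1 - x), and (0, gl) carries the rest. *)
Lemma quadratic_facet (x u y z : R) : gl < 0 -> 0 < gu -> bl < 0 ->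
  0 < x -> 0 < u -> u <= gu * x ->
  y + u <= 0 -> z + x <= 1 -> bl * z <= y -> y <= bu * z -> 0 < bu ->
  C (vec5 x u y z (gl + (u - bl * x) * (u - gl * x) / (- bl * x))).
Proof.
move=> hgl hgu hbl x0 u0 ugu yu zx ybl ybu hbu.
have [xN blN] : x != 0 /\ bl != 0 by rewrite gt_eqF // lt_eqF.
(* The mass l of the point on the curve; its abscissa is x / l. *)
have [l lE] : exists l, bl * l = bl * x - u.
  by exists ((bl * x - u) / bl); rewrite mulrC divfK ?lt_eqF.
have lx : 0 <= l - x by rewrite -(nmulr_rle0 _ hbl) mulrBr lE; lra.
have l1 : 0 <= z - (l - x) by rewrite -(nmulr_rle0 _ hbl) !mulrBr lE; lra.
have l0 : 0 <= l by lra.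
apply: hcone1.
rewrite (_ : 1 = l + (1 - l)); last by rewrite addrC subrK.
have -> : vec5 x u y z (gl + (u - bl * x) * (u - gl * x) / (- bl * x)) =
  vec5 (x + 0) (u + 0) (- u + (y + u)) ((l - x) + (z - (l - x)))
       (u / x * l + gl * (1 - l)).
  congr vec5; try ring.
  have -> : u - bl * x = - (bl * l) by rewrite lE; ring.
  by field; rewrite blN xN.
have ux : u / x <= gu by rewrite ler_pdivrMr.
have ux0 : 0 <= u / x by rewrite divr_ge0 // ltW.
apply: hcone_vec5D; apply: hcone_mass => //;
  rewrite ?mul0r ?mulr0 ?addr0 ?add0r //; try lra.
- by rewrite mulrA [x * _]mulrC divfK // gt_eqF.
- by have := mulr_ge0 (ltW hbu) lx; lra.
- by apply: ler_wpM2r => //; lra.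
- exact: ler_wpM2r.
- by have := mulr_ge0 (ltW hbu) l1; lra.
- by have : 0 <= (gu - gl) * (1 - l) by [apply: mulr_ge0; lra]; lra.
Qed.

(** The same facet as for g = gu above, but for u <= 0. All of u is now placed
    at x = 1, and the point (0, gu), where u = 0 only allows y <= 0, carries
    y and z. *)
Lemma mccormick_facet_upper (x u y z : R) : gl < 0 -> 0 < gu ->
  0 <= x -> x <= 1 -> u <= 0 -> gl * x <= u ->
  y <= 0 -> z + x <= 1 -> bl * z <= y -> y <= bu * z -> 0 <= z ->
  C (vec5 x u y z (gu - (gu * x - u))).
Proof.
move=> hgl hgu x0 x1 u0 ux y0 zx ybl ybu z0.
apply: hcone1.
rewrite (_ : 1 = x + (1 - x)); last by rewrite addrC subrK.
have -> : vec5 x u y z (gu - (gu * x - u)) =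
  vec5 (x + 0) (u + 0) (0 + y) (0 + z) (u + gu * (1 - x)).
  by congr vec5; ring.
have h : 0 <= gu * (1 - x) by apply: mulr_ge0; lra.
have h' : 0 <= - gl * (1 - x) by apply: mulr_ge0; lra.
have h'' : 0 <= gu * x by apply: mulr_ge0; lra.
apply: hcone_vec5D; apply: hcone_mass => //;
  rewrite ?mul0r ?mulr0 ?addr0 ?add0r //; try lra.
by move=> xE; move: ux; rewrite xE; lra.
Qed.

(** In the equality case all points with y > 0 have the same ratio y / w, and
    lie on the curve - x t = bu (1 - x), with y = - x t; one point is enough.
    The remaining points must not contribute to y or w, and must have x = 1 or
    t = gu: they are (1, gl) and (0, gu). *)
Lemma harmonic_facet (x u y z : R) : gl < 0 -> 0 < gu -> bl < 0 -> 0 < bu ->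
  0 < y -> gl * x <= u ->
  y + u <= 0 -> z + x <= 1 -> bl * z <= y -> y <= bu * z ->
  C (vec5 x u y z (gu - (gu * x - u) -
    ((gu - gl) * y + gl * y * (u - gl * x) / (y + u - gl * x)) / bu)).
Proof.
move=> hgl hgu hbl hbu y0 w0 yu zx ybl ybu.
have yw : 0 < y + u - gl * x by lra.
(* The point on the curve has mass m + n, abscissa m / (m + n) and t = t1. *)
have [m mE] : exists m, gl * m = - (y + u - gl * x).
  by exists (- (y + u - gl * x) / gl); rewrite mulrC divfK ?lt_eqF.
have [n nE] : exists n, bu * n = y.
  by exists (y / bu); rewrite mulrC divfK ?gt_eqF.
have m0 : 0 < m by rewrite -(nmulr_rlt0 _ hgl) mE; lra.
have n0 : 0 < n by rewrite -(pmulr_rgt0 _ hbu) nE.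
have xm : 0 <= x - m by rewrite -(nmulr_rle0 _ hgl) mulrBr mE; lra.
have zn : 0 <= z - n by rewrite -(pmulr_rge0 _ hbu) mulrBr nE; lra.
have [[glN buN] mN] : (gl != 0 /\ bu != 0) /\ m != 0.
  by rewrite lt_eqF // !gt_eqF.
pose t1 := - y / m.
have t1E : t1 * m = - y by rewrite divfK // gt_eqF.
have t10 : t1 <= 0 by rewrite -(pmulr_lle0 _ m0) t1E; lra.
have t1g : gl <= t1 by rewrite -(ler_pM2r m0) t1E mE; lra.
apply: hcone1.
rewrite (_ : 1 = (m + n) + (x - m) + (1 - x - n)); last by ring.
have -> : vec5 x u y z (gu - (gu * x - u) -
    ((gu - gl) * y + gl * y * (u - gl * x) / (y + u - gl * x)) / bu) =
  vec5 (m + (x - m) + 0) (- y + gl * (x - m) + 0) (y + 0 + 0)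
       (n + 0 + (z - n))
       (t1 * (m + n) + gl * (x - m) + gu * (1 - x - n)).
  congr vec5; try ring.
    by rewrite mulrBr mE; ring.
  have ywE : y + u - gl * x = - gl * m by rewrite mulNr mE; ring.
  have uE : u = - gl * m - y + gl * x by rewrite -ywE; ring.
  rewrite ywE uE /t1 -nE; field.
  by rewrite ?glN ?mN ?buN.
have h1 : 0 <= - t1 * n by apply: mulr_ge0; lra.
have h2 : 0 <= (t1 - gl) * n by apply: mulr_ge0; lra.
have h3 : 0 <= gu * (m + n) by apply: mulr_ge0; lra.
have h4 : 0 <= (gu - gl) * (x - m) by apply: mulr_ge0; lra.
have h5 : 0 <= - gl * (x - m) by apply: mulr_ge0; lra.
have h6 : 0 <= gu * (1 - x - n) by apply: mulr_ge0; lra.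
have h7 : 0 <= - gl * (1 - x - n) by apply: mulr_ge0; lra.
have h8 : 0 <= bu * (z - n) by apply: mulr_ge0; lra.
have h9 : 0 <= - bl * (z - n) by apply: mulr_ge0; lra.
have h10 : 0 <= - bl * n by apply: mulr_ge0; lra.
apply: hcone_vec5D; first apply: hcone_vec5D; apply: hcone_mass => //;
  rewrite ?mul0r ?mulr0 ?addr0 ?add0r //; try lra.
- by rewrite mulrA [m * t1]mulrC t1E.
- by move=> ->; rewrite mulr0.
Qed.

(** The ends a and b of the interval of admissible t are chosen according to the
    signs of u and y; when 0 < y, the second nonlinear inequality implies the
    McCormick inequality that gives the other upper end. *)
Lemma R1_sub_convex : gl < 0 -> 0 < gu -> bl < 0 -> 0 < bu -> R1 `<=` C.
Proof.
move=> hgl hgu hbl hbu v [[[yu zx ybu ybl] [w0 gx0 ws gxs]] lower upper].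
rewrite -(vec5K v); move: yu zx ybu ybl w0 gx0 ws gxs lower upper.
move: (cx v) (cu v) (cy v) (cz v) (ct v) => x u y z t.
move=> yu zx ybu ybl w0 gx0 ws gxs lower upper.
have [gP bP] : 0 < gu - gl /\ 0 < bu - bl by split; lra.
have x0 : 0 <= x by rewrite -(pmulr_rge0 _ gP) mulrBl; lra.
have x1 : x <= 1 by rewrite -(ler_pM2l gP) mulrBl; lra.
have z0 : 0 <= z by rewrite -(pmulr_rge0 _ bP) mulrBl; lra.
have gxu : gl * x <= u by lra.
have ugx : u <= gu * x by lra.
have [a Ca at_] : exists2 a, C (vec5 x u y z a) & a <= t.
  have [u0|u0] := leP u 0.
    have uE : gl * (u / gl) = u by rewrite mulrC divfK // lt_eqF.
    exists (gl + (u - gl * x)); last by lra.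
    rewrite -uE; apply: mccormick_facet; rewrite ?uE //; try lra.
      by rewrite -(nmulr_rle0 _ hgl) uE.
    by rewrite -(ler_nM2l hgl) uE.
  have xP : 0 < x by rewrite -(pmulr_rgt0 _ hgu); lra.
  exists (gl + (u - bl * x) * (u - gl * x) / (- bl * x)).
    exact: quadratic_facet.
  have bxP : 0 < - bl * x by apply: mulr_gt0; lra.
  have : (u - bl * x) * (u - gl * x) / (- bl * x) <= t - gl.
    by rewrite ler_pdivrMr //; lra.
  by lra.
have [b Cb tb] : exists2 b, C (vec5 x u y z b) & t <= b.
  have [y0|y0] := leP y 0.
    exists (gu - (gu * x - u)); last by lra.
    have [u0|u0] := leP 0 u; last by apply: mccormick_facet_upper; lra.
    have uE : gu * (u / gu) = u by rewrite mulrC divfK // gt_eqF.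
    rewrite (_ : gu - _ = gu + (u - gu * x)); last by ring.
    rewrite -uE; apply: mccormick_facet; rewrite ?uE //; try lra.
      by rewrite -(pmulr_rge0 _ hgu) uE.
    by rewrite -(ler_pM2l hgu) uE.
  exists (gu - (gu * x - u) -
    ((gu - gl) * y + gl * y * (u - gl * x) / (y + u - gl * x)) / bu).
    exact: harmonic_facet.
  have : ((gu - gl) * y + gl * y * (u - gl * x) / (y + u - gl * x)) / bu
         <= gu - t - (gu * x - u).
    by rewrite ler_pdivrMr //; have := upper y0; lra.
  by lra.
exact: segment_t Ca Cb at_ tb.
Qed.

End Decomposition.
End Hull.

Theorem theorem4p1 (R : realType) (gl gu bl bu : R)
    (hgl : gl < 0) (hgu : 0 < gu) (hbl : bl < 0) (hbu : 0 < bu) :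
  convex_hull (T_set gl gu bl bu) = R1_set gl gu bl bu.
Proof.
apply/seteqP; split.
  by apply: smallest_sub; [exact: convex_R1 | exact: T_sub_R1].
by move=> v R1v C [cC TC]; exact: R1_sub_convex R1v.
Qed.
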